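(* Let $d\ge 1$, $\alpha_1,\ldots,\alpha_d\in\mathbb{R}$, and for $t>0$ let $$Q_t(x_1,\ldots,x_d,y)=(x_1-\alpha_1y)^2+\cdots+(x_d-\alpha_dy)^2+ty^2 .$$ Let $M\in GL(d+1,\mathbb{Z})$, and let $(q_{ij})_{1\le i,j\le d+1}$ be the symmetric matrix of the quadratic form $\mathbf{x}\mapsto Q_t(M\mathbf{x})$ in $d+1$ variables. Let $B_{ij}$ ($1\le i\le j\le d+1$) and $C_i$ ($1\le i\le d$) be the determinants associated to this form as defined in the context. Then each of the determinants $B_{ij}$ and $C_i$ lies in $\mathbb{Z}[\alpha_1,\ldots,\alpha_d,t]$, is quadratic in $\alpha_1,\ldots,\alpha_d$ and linear in $t$, and the coefficient of $t$ is in $\mathbb{Z}$. That is, each of them is of the form $ut+v$ where $u\in\mathbb{Z}$ and $v$ is the value at $(\alpha_1,\ldots,\alpha_d)$ of a polynomial of total degree at most $2$ with integer coefficients, where $u$ and the polynomial depend only on $M$ and the indices.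
   Context: A quadratic form in $n$ variables is written $Q(\mathbf{x})=\sum_{i,j=1}^n q_{ij}x_ix_j$ with $q_{ij}=q_{ji}$ real; its matrix is $(q_{ij})$. For $1\le i\le j\le n$, $B_{ij}$ is the $i\times i$ determinant formed from rows $1,\ldots,i$ and columns $1,\ldots,i-1,j$ (in this order) of the matrix $(q_{ij})$: $$B_{ij}=\left|\begin{array}{cccc} q_{11}&\ldots&q_{1,i-1}&q_{1j}\\ q_{21}&\ldots&q_{2,i-1}&q_{2j}\\ \vdots&&\vdots&\vdots\\ q_{i1}&\ldots&q_{i,i-1}&q_{ij}\end{array}\right|.$$ For $1\le i<n$, $C_i$ is the subdeterminant of $B_{i+1,i+1}$ obtained by deleting the $i$-th row and the $i$-th column (so it is the $i\times i$ principal minor of $(q_{ij})$ on the indices $1,\ldots,i-1,i+1$). Here $n=d+1$. ''Quadratic'' and ''linear'' mean of degree at most $2$ and at most $1$, respectively. *)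

(* Defs.v *)
From HB Require Import structures.
From mathcomp Require Import all_boot all_order all_algebra.
From mathcomp Require Import reals mpoly.

Set Implicit Arguments.
Unset Strict Implicit.
Unset Printing Implicit Defensive.
Import Order.TTheory GRing.Theory Num.Theory.
Local Open Scope ring_scope.

Definition is_qf_matrix (R : realType) (n : nat)
    (q : 'M[R]_n) (Q : 'cV[R]_n -> R) : Prop :=
  q^T = q /\
  forall x : 'cV[R]_n, Q x = \sum_(i < n) \sum_(j < n) q i j * x i 0 * x j 0.

(* The coordinates of x : 'cV_(d.+1) are x_1, ..., x_d followed by y. *)
Definition Qform (R : realType) (d : nat) (alpha : 'I_d -> R) (t : R)
    (x : 'cV[R]_d.+1) : R :=
  let y := x ord_max 0 in
  \sum_(k < d) (x (widen_ord (leqnSn d) k) 0 - alpha k * y) ^+ 2 + t * y ^+ 2.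

(* Indices are 0-based: for i : 'I_n this is the matrix with rows 0, ..., i
   and columns 0, ..., i-1, j, in this order. *)
Definition Bmx (R : realType) (n : nat) (q : 'M[R]_n) (i j : 'I_n) :
    'M[R]_i.+1 :=
  let w := widen_ord (ltn_ord i) in
  \matrix_(k < i.+1, l < i.+1) q (w k) (if (l < i)%N then w l else j).

Definition Bdet (R : realType) (n : nat) (q : 'M[R]_n) (i j : 'I_n) : R :=
  \det (Bmx q i j).

(* [lift ord0 i] has value i+1. In Bmx q (i+1) (i+1), whose size is i+2, the
   row and column of 0-based index i are the last but one. *)
Definition Cdet (R : realType) (n : nat) (q : 'M[R]_n.+1) (i : 'I_n) : R :=
  let i1 : 'I_n.+1 := lift ord0 i in
  let k : 'I_i1.+1 := inord i in
  \det (row' k (col' k (Bmx q i1 i1))).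

Definition int_mpoly_eval (R : realType) (d : nat) (p : {mpoly int[d]})
    (alpha : 'I_d -> R) : R :=
  (map_mpoly intr p).@[alpha].

(* Main.v *)
Require Import Defs.
From HB Require Import structures.
From mathcomp Require Import all_boot all_order all_algebra.
From mathcomp Require Import reals mpoly.
From mathcomp Require Import perm ring lra.

Set Implicit Arguments.
Unset Strict Implicit.
Unset Printing Implicit Defensive.
Import Order.TTheory GRing.Theory Num.Theory.
Local Open Scope ring_scope.

(** Every [B_ij] and [C_i] is a minor of the Gram matrix [q] of the form
    [Q_t o M], and the statement holds for all minors of [q].

    For a minor of [q] with given row and column indices, keep the columns of
    [M] at the row indices and split off the last row: this gives integer
    matrices [X] (with [d] rows) and [x] (one row). The column indices give [Y]
    and [y] in the same way. Since [q] is symmetric it is determined by its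
    quadratic form, so the minor is the determinant of

      [(X - a x)^T (Y - a y) + t x^T y]
        [= X^T Y - (X^T a) y - x^T (a^T Y) + (a^T a + t) x^T y],

    where [a] is the column of the [alpha_k]. This is an integer matrix
    perturbed by terms of rank one, hence a Schur complement in a larger matrix
    having two more rows and columns (lemma [det_bordered]):

<<
      | X^T Y   X^T a      x^T |
      |   y       1         0  |
      | a^T Y  a^T a + t    1  |
>>

    In the bordered matrix the [alpha_k] occur only in one row and one column,
    linearly except for [a^T a] at their crossing, and [t] occurs only at the
    crossing. Each term of the Leibniz expansion takes one factor from that row
    and one from that column, so at [t = 0] the determinant has degree at most
    2 in the [alpha_k]. It is affine in [t], with slope the cofactor at the
    crossing; this cofactor omits both the row and the column, so it is an
    integer (lemma [mdeg_le_cross]). To get one polynomial for all values of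
    the [alpha_k], the bordered matrix is built over the integer polynomials
    and then evaluated. *)

(** * Bordered determinants *)

Section Determinants.
Variable S : comNzRingType.

(** The block [W *m D] makes the elimination [A - W *m C] available without
    inverting [D]; subtracting [W] times the lower rows clears it. *)
Lemma det_block_schur n m (A : 'M[S]_n) (W : 'M[S]_(n, m)) (C : 'M[S]_(m, n))
    (D : 'M[S]_m) :
  \det (block_mx A (W *m D) C D) = \det (A - W *m C) * \det D.
Proof.
rewrite -(det_lblock _ C D).
have -> : block_mx (A - W *m C) 0 C D
    = block_mx 1%:M (- W) 0 1%:M *m block_mx A (W *m D) C D.
  by rewrite mulmx_block !mul1mx !mul0mx !mulNmx !add0r subrr.
by rewrite det_mulmx det_ublock !det1 !mul1r.
Qed.

(** The cofactors along row [i] do not see an entry of row [i], so the Laplace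
    expansion along that row is affine in the entry. *)
Lemma det_add_delta n (A : 'M[S]_n) (i j : 'I_n) (t : S) :
  \det (A + t *: delta_mx i j) = \det A + t * cofactor A i j.
Proof.
have cofE l : cofactor (A + t *: delta_mx i j) i l = cofactor A i l.
  rewrite /cofactor; congr (_ * \det _); apply/matrixP => a b.
  by rewrite !mxE [lift i a == i]eq_sym (negbTE (neq_lift _ _)) mulr0 addr0.
rewrite (expand_det_row _ i) [\det A](expand_det_row _ i).
under eq_bigr => l _ do rewrite cofE !mxE eqxx mulrDl.
rewrite big_split /=; congr (_ + _).
rewrite (bigD1 j) //= eqxx mulr1 big1 ?addr0 // => l /negbTE ->.
by rewrite mulr0 mul0r.
Qed.

(** The lower right block is unitriangular with determinant 1 whatever its
    corner is. That corner is the only entry of the bordered matrix in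
    which [t] appears, and the only one of degree 2 in [a]. *)
Definition bordered d n (X Y : 'M[S]_(d, n)) (x y : 'rV[S]_n) (a : 'cV[S]_d)
    (t : S) : 'M[S]_(n + (1 + 1)) :=
  block_mx (X^T *m Y) (row_mx (X^T *m a) x^T)
           (col_mx y (a^T *m Y)) (block_mx 1%:M 0 (a^T *m a + t%:M) 1%:M).

Lemma det_bordered d n (X Y : 'M[S]_(d, n)) x y a t :
  \det (bordered X Y x y a t)
  = \det ((X - a *m x)^T *m (Y - a *m y) + t *: (x^T *m y)).
Proof.
pose s := a^T *m a + t%:M.
(* The upper right block, multiplied by the inverse of the unitriangular one. *)
have -> : bordered X Y x y a t
    = block_mx (X^T *m Y)
        (row_mx (X^T *m a - x^T *m s) x^T *m block_mx 1%:M 0 s 1%:M)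
        (col_mx y (a^T *m Y)) (block_mx 1%:M 0 s 1%:M).
  by rewrite /bordered mul_row_block !mulmx1 mulmx0 add0r subrK.
rewrite det_block_schur det_lblock !det1 !mulr1; congr (\det _).
rewrite mul_row_col /s [(X - _)^T]linearB /= trmx_mul !mulmxBl !mulmxBr.
rewrite mulmxDr mulmxDl mul_mx_scalar -scalemxAl !mulmxA.
by apply/matrixP => i j; rewrite !mxE; ring.
Qed.

Lemma borderedE d n (X Y : 'M[S]_(d, n)) x y a t :
  bordered X Y x y a t = bordered X Y x y a 0
    + t *: delta_mx (rshift n (rshift 1 0)) (rshift n (lshift 1 0)).
Proof.
apply/matrixP => i j; rewrite /bordered [in RHS]mxE [X in _ = _ + X]mxE.
case: (split_ordP i) => {}i ->; case: (split_ordP j) => {}j ->;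
  rewrite ?(block_mxEul, block_mxEur, block_mxEdl, block_mxEdr)
    [delta_mx _ _ _ _]mxE
    ?(eq_lshift, eq_rshift, eq_lrshift, eq_rlshift) ?andbF ?mulr0 ?addr0 //.
case: (split_ordP i) => {}i ->; case: (split_ordP j) => {}j ->;
  rewrite ?(block_mxEul, block_mxEur, block_mxEdl, block_mxEdr)
    ?(eq_lshift, eq_rshift, eq_lrshift, eq_rlshift) ?andbF ?mulr0 ?addr0 //.
by rewrite !ord1 !mxE mulr1 mul0rn addr0.
Qed.

End Determinants.

Lemma map_bordered (S S' : comNzRingType) (phi : {rmorphism S -> S'}) d n
    (X Y : 'M[S]_(d, n)) x y a t :
  map_mx phi (bordered X Y x y a t) =
  bordered (map_mx phi X) (map_mx phi Y) (map_mx phi x) (map_mx phi y)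
    (map_mx phi a) (phi t).
Proof.
rewrite /bordered !map_block_mx map_row_mx map_col_mx.
by rewrite map_mxD !map_mxM !map_scalar_mx rmorph1 map_mx0 !map_trmx.
Qed.

(** * Degrees of determinants of polynomial matrices *)

Section Degree.
Variables (d : nat) (S : idomainType).
Implicit Types p q : {mpoly S[d]}.

(** [msize] is one more than the degree, and 0 on the zero polynomial; this
    predicate makes the bounds additive under products. *)
Definition mdeg_le k p := (msize p <= k.+1)%N.

Lemma mdeg_le_sum I (r : seq I) (P : pred I) (F : I -> {mpoly S[d]}) k :
  (forall i, P i -> mdeg_le k (F i)) -> mdeg_le k (\sum_(i <- r | P i) F i).
Proof.
move=> Fk; apply: (big_ind (mdeg_le k)) => //; first by rewrite /mdeg_le msize0.
move=> p q pk qk; apply: leq_trans (msizeD_le _ _) _.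
by rewrite geq_max; apply/andP.
Qed.

Lemma mdeg_leM k l p q : mdeg_le k p -> mdeg_le l q -> mdeg_le (k + l) (p * q).
Proof.
move=> pk ql; have [->|p0] := eqVneq p 0; first by rewrite mul0r /mdeg_le msize0.
have [->|q0] := eqVneq q 0; first by rewrite mulr0 /mdeg_le msize0.
by rewrite /mdeg_le msizeM // -subn1 leq_subLR add1n -addSn -addnS leq_add.
Qed.

Lemma mdeg_le_prod I (r : seq I) (F : I -> {mpoly S[d]}) (w : I -> nat) :
  (forall i, mdeg_le (w i) (F i)) ->
  mdeg_le (\sum_(i <- r) w i) (\prod_(i <- r) F i).
Proof.
move=> Fw; elim/big_rec2: _ => [|i k p _ pk]; last exact: mdeg_leM.
by rewrite /mdeg_le msize1.
Qed.

Lemma mdeg_leZsign k (b : bool) p : mdeg_le k p -> mdeg_le k ((-1) ^+ b * p).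
Proof. by case: b; rewrite ?mulN1r ?mul1r // /mdeg_le msizeN. Qed.

(** A term of the Leibniz formula meets every row and every column exactly
    once, so it collects each weight [r i] and [c j] once. *)
Lemma mdeg_le_det n (A : 'M[{mpoly S[d]}]_n) (r c : 'I_n -> nat) :
  (forall i j, mdeg_le (r i + c j) (A i j)) ->
  mdeg_le (\sum_i r i + \sum_j c j) (\det A).
Proof.
move=> Arc; apply: mdeg_le_sum => s _; apply: mdeg_leZsign.
rewrite [X in (_ + X)%N](reindex_inj (@perm_inj _ s)) -big_split /=.
exact: mdeg_le_prod.
Qed.

Lemma mdeg_leC k (c : S) : mdeg_le k (c%:MP : {mpoly S[d]}).
Proof. by rewrite /mdeg_le msizeC; case: (c == 0). Qed.

Lemma mdeg_leX i : mdeg_le 1 ('X_i : {mpoly S[d]}).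
Proof. by rewrite /mdeg_le msizeX mdeg1. Qed.

(** When only row [i0] and column [j0] carry variables, at their crossing with
    degree 2, the total weight is 2; the cofactor at the crossing has lost the
    row and the column, hence all the weight. *)
Lemma mdeg_le_cross n (A : 'M[{mpoly S[d]}]_n) (i0 j0 : 'I_n) :
  (forall i j, mdeg_le ((i == i0) + (j == j0)) (A i j)) ->
  mdeg_le 2 (\det A) /\ mdeg_le 0 (cofactor A i0 j0).
Proof.
have sum1 (k : 'I_n) : (\sum_(i < n) (i == k) = 1)%N.
  by rewrite (bigD1 k) //= eqxx big1 // => i /negbTE ->.
move=> Across; split.
  by have := mdeg_le_det Across; rewrite !sum1.
rewrite /cofactor -signr_odd; apply: mdeg_leZsign.
have := @mdeg_le_det _ (row' i0 (col' j0 A)) (fun=> 0%N) (fun=> 0%N).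
rewrite !big1 //; apply=> i j; rewrite !mxE.
have := Across (lift i0 i) (lift j0 j).
by rewrite !(eq_sym (lift _ _)) !(negbTE (neq_lift _ _)).
Qed.

Lemma mdeg_le_bordered n (X Y : 'M[S]_(d, n)) (x y : 'rV[S]_n) :
  let C m := map_mx (@mpolyC d S) : 'M_(m, n) -> 'M_(m, n) in
  forall i j,
  mdeg_le ((i == rshift n (rshift 1 0)) + (j == rshift n (lshift 1 0)))
    (bordered (C d X) (C d Y) (C 1 x) (C 1 y) (\col_k 'X_k) 0 i j).
Proof.
move=> C i j; rewrite /bordered /C.
have eqs := (eq_lshift, eq_rshift, eq_lrshift, eq_rlshift, block_mxEul,
  block_mxEur, block_mxEdl, block_mxEdr, row_mxEl, row_mxEr, col_mxEu, col_mxEd).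
have linX (m : nat) (Z : 'M[S]_(d, m)) u :
  mdeg_le 1 (\sum_k (Z k u)%:MP * 'X_k).
  apply: mdeg_le_sum => k _.
  by apply: (mdeg_leM (k := 0)); [exact: mdeg_leC | exact: mdeg_leX].
case: (split_ordP i) => {}i ->; case: (split_ordP j) => {}j ->; rewrite !eqs.
- by rewrite map_trmx -map_mxM mxE; exact: mdeg_leC.
- case: (split_ordP j) => {}j ->; rewrite !eqs ?ord1; last first.
    by rewrite !mxE; exact: mdeg_leC.
  rewrite mxE eqxx.
  under eq_bigr do rewrite !mxE.
  exact: linX.
- case: (split_ordP i) => {}i ->; rewrite !eqs ?ord1.
    by rewrite !mxE; exact: mdeg_leC.
  rewrite mxE eqxx.
  under eq_bigr do rewrite mulrC !mxE.
  exact: linX.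
- case: (split_ordP i) => {}i ->; case: (split_ordP j) => {}j ->;
    rewrite !eqs ?ord1 ?eqxx.
  + by rewrite mxE; exact: mdeg_leC.
  + by rewrite mxE; exact: mdeg_leC.
  + rewrite !mxE mul0rn addr0; apply: mdeg_le_sum => k _; rewrite !mxE.
    by apply: (mdeg_leM (k := 1)); exact: mdeg_leX.
  + by rewrite mxE; exact: mdeg_leC.
Qed.

End Degree.

(** * The matrix of the quadratic form *)

Section Form.
Variable R : realType.

Lemma quadratic_formE n (q : 'M[R]_n) (x : 'cV[R]_n) :
  \sum_(i < n) \sum_(j < n) q i j * x i 0 * x j 0 = (x^T *m q *m x) 0 0.
Proof.
rewrite exchange_big mxE; apply: eq_bigr => j _ /=.
rewrite mxE mulr_suml; apply: eq_bigr => i _.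
by rewrite mxE [q i j * _]mulrC.
Qed.

(** Polarization: a symmetric matrix whose quadratic form vanishes on the
    vectors [e_i] and [e_i + e_j] is zero in characteristic 0. *)
Lemma qf_matrix_inj n (q q' : 'M[R]_n) (Q : 'cV[R]_n -> R) :
  is_qf_matrix q Q -> is_qf_matrix q' Q -> q = q'.
Proof.
move=> [q_sym qQ] [q'_sym q'Q].
pose D := q - q'.
have D_sym i j : D j i = D i j.
  by rewrite -[in LHS](_ : D^T = D) ?mxE // linearB /= q_sym q'_sym.
have D_null (x : 'cV[R]_n) : (x^T *m D *m x) 0 0 = 0.
  by rewrite mulmxBr mulmxBl mxE [X in _ + X]mxE -!quadratic_formE -qQ -q'Q subrr.
pose e i : 'cV[R]_n := delta_mx i 0.
have eDe i j : ((e i)^T *m D *m e j) 0 0 = D i j.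
  by rewrite trmx_delta -rowE -colE !mxE.
have D_diag i : D i i = 0 by rewrite -eDe D_null.
suff D0 : D = 0 by apply/eqP; rewrite -subr_eq0 -/D D0.
apply/matrixP => i j; rewrite [RHS]mxE.
have := D_null (e i + e j).
clearbody D.
have addE (A B : 'M[R]_1) : (A + B) 0 0 = A 0 0 + B 0 0 by rewrite mxE.
have -> : (e i + e j)^T = (e i)^T + (e j)^T by rewrite linearD.
rewrite !mulmxDl !mulmxDr !addE !eDe !D_diag D_sym.
lra.
Qed.

(** The linear forms squared in [Qform] have the rows of [A] and the row [x] as
    coefficients, so the matrix is a weighted Gram matrix of these rows. *)
Lemma qf_matrix_Qform d (alpha : 'I_d -> R) t (N : 'M[R]_d.+1) :
  let x := row ord_max N in
  let A := rowsub (widen_ord (leqnSn d)) N - \col_k alpha k *m x in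
  is_qf_matrix (A^T *m A + t *: (x^T *m x)) (fun z => Qform alpha t (N *m z)).
Proof.
move=> x A; split=> [|z].
  by rewrite linearD linearZ /= !trmx_mul !trmxK.
have xz : (x *m z) 0 0 = (N *m z) ord_max 0 by rewrite -row_mul mxE.
clearbody x.
rewrite quadratic_formE mulmxDr mulmxDl -scalemxAr -scalemxAl !mulmxA -!trmx_mul.
rewrite -2!mulmxA /Qform -xz [RHS]mxE; congr (_ + _).
  rewrite [RHS]mxE; apply: eq_bigr => k _; rewrite [_^T _ _]mxE -expr2.
  congr (_ ^+ 2); rewrite /A mulmxBl -mulmxA mul_rowsub_mx.
  rewrite [RHS]mxE [X in _ = _ + X]mxE [X in _ = _ - X]mxE big_ord1.
  by rewrite [X in _ = X - _]mxE [X in _ = _ - X * _]mxE.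
by rewrite [RHS]mxE [X in _ = _ * X]mxE big_ord1 [_^T _ _]mxE.
Qed.
End Form.

(** * Minors of the form *)

(** The maps [f] and [g] choose rows and columns of [q] in any order, so that
    both kinds of determinants are instances; they turn into choices of columns
    of [M] on the two sides of the Gram product. *)
Lemma minor_form (R : realType) d (M : 'M[int]_d.+1) n (f g : 'I_n -> 'I_d.+1) :
  exists (u : int) (p : {mpoly int[d]}), (msize p <= 3)%N /\
    forall (alpha : 'I_d -> R) (t : R) (q : 'M[R]_d.+1),
      is_qf_matrix q (fun x => Qform alpha t (map_mx intr M *m x)) ->
      \det (mxsub f g q) = u%:~R * t + int_mpoly_eval p alpha.
Proof.
pose C m (Z : 'M[int]_(m, n)) := map_mx (@mpolyC d int) Z.
pose top (h : 'I_n -> _) := mxsub (widen_ord (leqnSn d)) h M.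
pose bot h : 'rV_n := mxsub (fun=> ord_max) h M.
pose K := bordered (C d (top f)) (C d (top g)) (C 1 (bot f)) (C 1 (bot g))
            (\col_k 'X_k) 0.
pose i0 : 'I_(n + (1 + 1)) := rshift n (rshift 1 0).
pose j0 : 'I_(n + (1 + 1)) := rshift n (lshift 1 0).
have [degK degcof] : mdeg_le 2 (\det K) /\ mdeg_le 0 (cofactor K i0 j0).
  by apply: mdeg_le_cross; exact: mdeg_le_bordered.
(* A polynomial of degree at most 0 is its constant coefficient. *)
exists (cofactor K i0 j0)@_0, (\det K); split=> // alpha t q q_form.
rewrite (qf_matrix_inj q_form (qf_matrix_Qform alpha t _)).
pose phi : {rmorphism {mpoly int[d]} -> R} := meval alpha \o map_mpoly intr.
have phiC c : phi c%:MP = c%:~R by rewrite /phi /= map_mpolyC mevalC.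
have phiX k : phi 'X_k = alpha k by rewrite /phi /= map_mpolyX mevalXU.
have phi_C m (Z : 'M[int]_(m, n)) : map_mx phi (C m Z) = map_mx intr Z.
  by apply/matrixP => a b; rewrite !mxE phiC.
have phi_X : map_mx phi (\col_k 'X_k) = \col_k alpha k.
  by apply/matrixP => a b; rewrite !mxE phiX.
have phiK : map_mx phi K = bordered (map_mx intr (top f)) (map_mx intr (top g))
    (map_mx intr (bot f)) (map_mx intr (bot g)) (\col_k alpha k) 0.
  by rewrite map_bordered !phi_C phi_X rmorph0.
have -> : ((cofactor K i0 j0)@_0)%:~R = cofactor (map_mx phi K) i0 j0.
  by rewrite cofactor_map_mx (msize1_polyC degcof) mcoeffC eqxx mulr1 phiC.
rewrite -[int_mpoly_eval _ _]/(phi (\det K)) -det_map_mx [RHS]addrC [_ * t]mulrC.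
rewrite -det_add_delta phiK -borderedE det_bordered; congr (\det _).
apply/matrixP => a b; rewrite !mxE; congr (_ + _ * _); last first.
  by apply: eq_bigr => k _; rewrite !mxE.
by apply: eq_bigr => k _; rewrite !mxE !big_ord1 !mxE.
Qed.

Theorem proposition4p3 (R : realType) (d : nat) (hd : (1 <= d)%N)
    (M : 'M[int]_d.+1) (hM : M \in unitmx) :
  (forall i j : 'I_d.+1, (i <= j)%N ->
     exists (u : int) (p : {mpoly int[d]}), (msize p <= 3)%N /\
       forall (alpha : 'I_d -> R) (t : R) (q : 'M[R]_d.+1), 0 < t ->
         is_qf_matrix q (fun x => Qform alpha t (map_mx intr M *m x)) ->
         Bdet q i j = u%:~R * t + int_mpoly_eval p alpha)
  /\
  (forall i : 'I_d,
     exists (u : int) (p : {mpoly int[d]}), (msize p <= 3)%N /\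
       forall (alpha : 'I_d -> R) (t : R) (q : 'M[R]_d.+1), 0 < t ->
         is_qf_matrix q (fun x => Qform alpha t (map_mx intr M *m x)) ->
         Cdet q i = u%:~R * t + int_mpoly_eval p alpha).
Proof.
split=> [i j _ | i].
  pose w := widen_ord (ltn_ord i).
  have [u [p [p_deg minorE]]] :=
    minor_form R M w (fun l => if (l < i)%N then w l else j).
  exists u, p; split=> // alpha t q _ /minorE <-.
  by congr (\det _); apply/matrixP => a b; rewrite !mxE.
(* Deleting row and column [k] precomposes the index maps with [lift k]. *)
pose i1 : 'I_d.+1 := lift ord0 i; pose k : 'I_i1.+1 := inord i.
pose w := widen_ord (ltn_ord i1).
have [u [p [p_deg minorE]]] := minor_form R M (fun a => w (lift k a))
  (fun l => if (lift k l < i1)%N then w (lift k l) else i1).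
exists u, p; split=> // alpha t q _ /minorE <-.
by congr (\det _); apply/matrixP => a b; rewrite !mxE.
Qed.
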